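(* Let $N\ge1$ be an integer and let $\tau$ be an even integer with $0\le\tau\le N-1$. Let ${\bf F}\in\mathbb{R}^N$ and suppose that ${\bf f}=\mathcal{DFT}\{{\bf F}\}$ satisfies $f(k)=0$ for all $k\in\{0,\ldots,N-1\}\setminus CS$. Then the vector ${\bf s}=\mathrm{sign}({\bf F})\in\{-1,1\}^N$ has at most $\tau$ sign changes, i.e. there are at most $\tau$ indices $j\in\{0,\ldots,N-2\}$ with $s_j\ne s_{j+1}$.
   Context: Vectors are indexed as ${\bf F}=(F_0,\ldots,F_{N-1})$. With $\omega_j=2\pi j/N$ and $\mathrm{i}=\sqrt{-1}$, the discrete Fourier transform is $$\mathcal{DFT}\{{\bf F}\}(k)=\frac1N\sum_{j=0}^{N-1}F_j e^{\mathrm{i}\omega_j k},\qquad k=0,\ldots,N-1.$$ The compact support set of length $\tau+1$ is $$CS=\{k\in\{0,\ldots,N-1\}: k\equiv \ell \ (\mathrm{mod}\ N)\ \text{for some integer } \ell \text{ with } -\tau/2\le \ell\le \tau/2\}.$$ Sign convention: $s_j=1$ if $F_j>0$ and $s_j=-1$ if $F_j<0$; if $F_j=0$ with $j\ge1$ then $s_j=s_{j-1}$; if $F_0=0$ then $s_0=1$. *)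

(* Defs.v *)
From mathcomp Require Import all_boot all_order all_algebra.
From mathcomp Require Import complex.
From mathcomp Require Import reals trigo.
Set Implicit Arguments.
Unset Strict Implicit.
Unset Printing Implicit Defensive.
Import Order.TTheory GRing.Theory Num.Theory.
Local Open Scope ring_scope.
Local Open Scope complex_scope.

(* Vectors (F_0, ..., F_{N-1}) are N-tuples, so that F`_j is F_j. *)

(* e^{ix}, through Euler's formula *)
Definition expi (R : realType) (x : R) : R[i] := cos x +i* sin x.

Definition omega (R : realType) (N j : nat) : R := 2 * pi * j%:R / N%:R.

(* The normalization 1/N and the positive exponent are both intended. *)
Definition dft (R : realType) (N : nat) (F : N.-tuple R) : N.-tuple R[i] :=
  [tuple N%:R^-1 * (\sum_(j < N) (F`_j)%:C * expi (omega R N j * k%:R))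
  | k < N].

Definition compact_support (N tau : nat) (k : 'I_N) : Prop :=
  exists l : int,
    (k%:Z = l %[mod N%:Z])%Z /\ - (tau%:Q / 2) <= l%:Q <= tau%:Q / 2.

(* A zero entry inherits the sign of its predecessor, and a zero entry of
   index 0 has sign 1. *)
Fixpoint sign_at (R : realType) (u : nat -> R) (j : nat) : int :=
  if 0 < u j then 1
  else if u j < 0 then -1
  else if j is j'.+1 then sign_at u j' else 1.

Definition sign_vector (R : realType) (N : nat) (F : N.-tuple R) :
    N.-tuple int :=
  [tuple sign_at (nth 0 F) j | j < N].

Definition sign_changes (N : nat) (s : N.-tuple int) : nat :=
  #|[set j : 'I_N.-1 | s`_j != s`_j.+1]|.

(* Main.v *)
Require Import Defs.
From mathcomp Require Import all_boot all_order all_algebra.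
From mathcomp Require Import complex polyrcf boolp.
From mathcomp Require Import reals trigo zify ring lra.
Import Order.TTheory GRing.Theory Num.Theory.
Local Open Scope ring_scope.
Local Open Scope complex_scope.

(** The reason behind the bound is that a band-limited vector samples a
    trigonometric polynomial of degree at most m = tau/2. Unless it is zero, in
    which case there are no sign changes, it has at most 2m = tau zeros per
    period, and each sign change uses up one of them.

    To count zeros of an ordinary real polynomial instead of a trigonometric
    one, the circle is opened up by the tangent of the half angle. Fourier
    inversion [dft_inversion] writes F_j as the sum of f(k) e^{-i omega_j k};
    on the support, k may be replaced by an integer l with |l| <= m. Let
    omega_j = 2 a_j + beta, where the constant rotation beta = pi - pi/N is
    chosen such that every a_j lies in ]-pi/2, pi/2[. From
    e^{+-ia} = cos a (1 +- i tan a), every e^{-2ial} with |l| <= m is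
    cos^{2m} a times a complex polynomial of degree at most 2m in tan a
    ([frequency_polyP]). Summing over k and taking real parts yields one real
    polynomial p of degree at most tau with F_j = cos^tau(a_j) p(tan a_j)
    ([bandlimited_polynomial]).

    Since cos a_j > 0 and tan a_j increases with j, the sign changes of F are
    those of p along an increasing sequence of points. A sign change at j
    produces a root of p in [x_j, x_{j+1}[ by the intermediate value theorem;
    these intervals are disjoint, so there are at most deg p of them
    ([card_poly_sign_changes]). *)

(** * Signs and roots of polynomials *)

Lemma sign_atP (R : realType) (u : nat -> R) (j : nat) :
  sign_at u j = 1 \/ sign_at u j = -1.
Proof.
elim: j => [|j IHj] /=; do 2![case: ifP => _; first by [left|right]] => //.
by left.
Qed.

(** A zero entry never starts a new sign, so a change between j and j+1 is
    always caused by a nonzero entry at j+1. The entry at j may be zero,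
    hence the weak inequality: index j itself is then the zero to be counted. *)
Lemma sign_at_change (R : realType) (u : nat -> R) (j : nat) :
  sign_at u j != sign_at u j.+1 -> u j.+1 != 0 /\ u j * u j.+1 <= 0.
Proof.
have sg_gt0 k : 0 < u k -> sign_at u k = 1 by case: k => [|k] /= ->.
have sg_lt0 k : u k < 0 -> sign_at u k = -1.
  by move=> uk; case: k uk => [|k] uk /=; rewrite ltNge ltW //= uk.
case: (ltgtP (u j.+1) 0) => [u1|u1|/= ->]; last by rewrite ltxx eqxx.
- rewrite (sg_lt0 _ u1) => neq; split=> //.
  rewrite nmulr_lle0 // leNgt; apply: contra neq => u0.
  by rewrite (sg_lt0 _ u0).
- rewrite (sg_gt0 _ u1) => neq; split=> //.
  rewrite pmulr_lle0 // leNgt; apply: contra neq => u0.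
  by rewrite (sg_gt0 _ u0).
Qed.

(** Each index in A yields a root in the half-open interval [x_i, x_{i+1}[,
    and distinct indices yield disjoint intervals. *)
Lemma card_poly_sign_changes (R : rcfType) (p : {poly R}) (n : nat)
    (x : nat -> R) (A : {set 'I_n}) :
  (forall i j, (i < j)%N -> (j <= n)%N -> x i < x j) ->
  (forall i, i \in A -> p.[x i.+1] != 0 /\ p.[x i] * p.[x i.+1] <= 0) ->
  (#|A| <= (size p).-1)%N.
Proof.
move=> x_incr chA.
have [->|[i0 Ai0]] := set_0Vmem A; first by rewrite cards0.
have p_neq0 : p != 0.
  by apply: contraTneq (chA _ Ai0).1 => ->; rewrite horner0 eqxx.
have /fin_all_exists[y yP] (i : 'I_n) :
    exists y, i \in A -> [/\ x i <= y, y < x i.+1 & root p y].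
  have [Ai|] := boolP (i \in A); last by exists 0.
  have [pi1 pii1] := chA i Ai.
  have lexx : x i <= x i.+1 by rewrite ltW ?x_incr.
  have [y] := polyrcf.poly_ivt lexx pii1; rewrite in_itv /=.
  move=> /andP[ley yle] py.
  exists y => _; split=> //; rewrite lt_neqAle yle andbT.
  by apply: contraNneq pi1 => <-.
(* The intervals are closed on the left, where p may vanish at x_i, and open
   on the right, where it does not; so adjacent ones share no root. *)
have y_mono : {in A &, forall i j : 'I_n, (i < j)%N -> y i < y j}.
  move=> i j /yP[_ yi _] /yP[yj _ _] ltij; apply: lt_le_trans yi _.
  apply: le_trans yj; move: ltij; rewrite leq_eqVlt => /orP[/eqP-> //|ltij].
  by rewrite ltW // x_incr // ltnW.
suff : (size [seq y i | i <- enum A] < size p)%N.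
  by rewrite size_map -cardE; case: (size p).
apply: max_poly_roots => //.
  by apply/allP => _ /mapP[i + ->]; rewrite mem_enum => /yP[].
rewrite map_inj_in_uniq ?enum_uniq // => i j; rewrite !mem_enum => Ai Aj yij.
apply: val_inj; case: (ltngtP i j) => //= ltij.
  by move: (y_mono _ _ Ai Aj ltij); rewrite yij ltxx.
by move: (y_mono _ _ Aj Ai ltij); rewrite yij ltxx.
Qed.

(** * The exponential on the unit circle *)

Lemma expiD (R : realType) (x y : R) : expi (x + y) = expi x * expi y.
Proof. by rewrite /expi cosD sinD [X in _ +i* X]addrC. Qed.

Lemma expi0 (R : realType) : expi (0 : R) = 1.
Proof. by rewrite /expi cos0 sin0. Qed.

Lemma expiMn (R : realType) (x : R) (n : nat) : expi (x * n%:R) = expi x ^+ n.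
Proof.
elim: n => [|n IHn]; first by rewrite mulr0 expi0.
by rewrite exprS -IHn -expiD mulrSr mulrDr mulr1 addrC.
Qed.

Lemma expi_mulN (R : realType) (x : R) : expi x * expi (- x) = 1.
Proof. by rewrite -expiD subrr expi0. Qed.

Lemma expi_neq0 (R : realType) (x : R) : expi x != 0.
Proof.
by apply: contra_eq_neq (expi_mulN R x) => ->; rewrite mul0r eq_sym oner_eq0.
Qed.

Lemma expi_cos_tan (R : realType) (x : R) :
  cos x != 0 -> expi x = (cos x)%:C * (1 + 'i * (tan x)%:C).
Proof.
move=> cx; rewrite /expi; apply/eqP; rewrite eq_complex /=.
rewrite !(mul0r, mulr0, subr0, addr0, add0r, mulr1, mul1r).
by rewrite /tan mulrCA divff // mulr1 !eqxx.
Qed.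

(** Already the real part forces this: cos x = 1 - 2 sin^2 (x/2), and sin (x/2)
    is positive for x strictly between 0 and 2 pi. *)
Lemma expi_eq1 (R : realType) (x : R) : 0 <= x < 2 * pi -> expi x = 1 -> x = 0.
Proof.
move=> /andP[x_ge0 x_lt] [cx _]; apply/eqP; move: x_ge0.
rewrite le_eqVlt => /orP[|x_gt0]; first by rewrite eq_sym.
have s_gt0 : 0 < sin (x / 2) by apply: sin_gt0_pi; lra.
move: cx; have -> : x = (x / 2) *+ 2 by lra.
rewrite cos_mulr2n cos2sin2 => cx.
suff /eqP : sin (x / 2) ^+ 2 = 0 by rewrite expf_eq0 gt_eqF.
lra.
Qed.

(** * Fourier inversion *)

Lemma expi_omegaX (R : realType) (N j : nat) :
  (0 < N)%N -> expi (omega R N j) ^+ N = 1.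
Proof.
move=> N_gt0; rewrite -expiMn /omega divfK ?pnatr_eq0 -?lt0n // expiMn.
by rewrite mulr_natl /expi cos2pi sin2pi expr1n.
Qed.

Lemma expi_omega_inj (R : realType) (N i j : nat) :
  (i < N)%N -> (j < N)%N -> expi (omega R N i) = expi (omega R N j) -> i = j.
Proof.
wlog leij : i j / (i <= j)%N => [hw ltiN ltjN eqij|ltiN ltjN eqij].
  case: (leqP i j) => [/hw|/ltnW/hw hw']; first exact.
  exact/esym/hw'.
have N_gt0 : 0 < N%:R :> R by rewrite ltr0n (leq_ltn_trans _ ltjN).
have omegaB : omega R N j = omega R N (j - i) + omega R N i.
  by rewrite /omega natrB //; field; rewrite gt_eqF.
have : omega R N (j - i) = 0.
  apply: expi_eq1.
    rewrite divr_ge0 ?mulr_ge0 ?pi_ge0 ?ler0n // ltr_pdivrMr //=.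
    rewrite ltr_pM2l ?mulr_gt0 ?pi_gt0 // ltr_nat.
    exact: leq_ltn_trans (leq_subr i j) ltjN.
  apply: (mulIf (expi_neq0 R (omega R N i))).
  by rewrite -expiD -omegaB mul1r.
move=> /eqP; rewrite !mulf_eq0 invr_eq0 (gt_eqF N_gt0) (gt_eqF (pi_gt0 R)).
rewrite !pnatr_eq0 orbF /= subn_eq0 => leji.
by apply/eqP; rewrite eqn_leq leij leji.
Qed.

(** Substituting the definition of the transform, the coefficient of F_i is
    the geometric sum of the powers of e^{i(omega_i - omega_j)}, an N-th root
    of unity: it vanishes unless i = j. *)
Lemma dft_inversion (R : realType) (N : nat) (F : N.-tuple R) (j : 'I_N) :
  (F`_j)%:C = \sum_(k < N) tnth (dft F) k / expi (omega R N j) ^+ k.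
Proof.
have N_gt0 : (0 < N)%N by apply: leq_ltn_trans (ltn_ord j).
have N_neq0 : N%:R != 0 :> R[i] by rewrite pnatr_eq0 -lt0n.
pose r (i : 'I_N) := expi (omega R N i) / expi (omega R N j).
have sum_r (i : 'I_N) : \sum_(k < N) r i ^+ k = if i == j then N%:R else 0.
  case: eqVneq => [->|neq_ij].
    rewrite /r divff ?expi_neq0 // (eq_bigr (fun=> 1)) => [|k _]; last first.
      exact: expr1n.
    by rewrite sumr_const card_ord.
  have r_neq1 : r i - 1 != 0.
    rewrite subr_eq0; apply: contra neq_ij => /eqP ri1; apply/eqP/val_inj.
    apply: (expi_omega_inj R N _ _ (ltn_ord i) (ltn_ord j)).
    by rewrite -[RHS]mul1r -ri1 /r divfK ?expi_neq0.
  apply: (mulfI r_neq1); rewrite -subrX1 mulr0 /r exprMn exprVn.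
  by rewrite !expi_omegaX // invr1 mulr1 subrr.
transitivity (\sum_(k < N) \sum_(i < N) N%:R^-1 * (F`_i)%:C * r i ^+ k).
  rewrite exchange_big /= (bigD1 j) //= [X in _ + X]big1 ?addr0 => [|i neq_ij].
    by rewrite -mulr_sumr sum_r eqxx mulrAC mulVf // mul1r.
  by rewrite -mulr_sumr sum_r (negPf neq_ij) mulr0.
apply: eq_bigr => k _; rewrite tnth_mktuple -mulrA mulr_suml mulr_sumr.
by apply: eq_bigr => i _; rewrite expiMn /r exprMn exprVn !mulrA.
Qed.

(** * From trigonometric to real polynomials *)

(** Half of omega_j, rotated by the constant pi/(2N) - pi/2 that centres the
    N angles in the open interval where the tangent increases. *)
Definition half_angle (R : realType) (N j : nat) : R :=
  pi * ((2 * j + 1)%:R - N%:R) / (2 * N%:R).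

Lemma half_angle_itv (R : realType) (N j : nat) :
  (j < N)%N -> half_angle R N j \in `]- (pi / 2), (pi / 2)[.
Proof.
move=> ltjN; have N_gt0 : 0 < N%:R :> R by rewrite ltr0n (leq_ltn_trans _ ltjN).
have : j%:R + 1 <= N%:R :> R by rewrite natr1 ler_nat.
have : 0 <= j%:R :> R by [].
rewrite /half_angle natrD natrM => j_ge0 jN; have := pi_gt0 R => pi_gt0.
rewrite in_itv /= ltr_pdivlMr ?mulr_gt0 // ltr_pdivrMr ?mulr_gt0 //.
by apply/andP; split; nra.
Qed.

Lemma cos_half_angle_gt0 (R : realType) (N j : nat) :
  (j < N)%N -> 0 < cos (half_angle R N j).
Proof.
move=> /(half_angle_itv R); rewrite in_itv /= => itv.
exact: cos_gt0_pihalf.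
Qed.

Lemma ltr_half_angle (R : realType) (N i j : nat) :
  (0 < N)%N -> (i < j)%N -> half_angle R N i < half_angle R N j.
Proof.
move=> N_gt0 ltij; rewrite ltr_pM2r ?invr_gt0 ?mulr_gt0 ?ltr0n //.
by rewrite ltr_pM2l ?pi_gt0 // ltrD2r ltr_nat ltn_add2r ltn_pmul2l.
Qed.

Lemma omega_half_angle (R : realType) (N j : nat) : (0 < N)%N ->
  omega R N j = half_angle R N j * 2 + (pi - pi / N%:R).
Proof.
move=> N_gt0; rewrite /omega /half_angle natrD natrM; field.
by rewrite pnatr_eq0 -lt0n.
Qed.

(** In the variable t = tan x, this is e^{i(d - 2n)x} divided by cos^d x: of
    the d factors e^{+-ix} = cos x (1 +- it), d - n carry the sign + and n the
    sign -. *)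
Definition frequency_poly (R : realType) (d n : nat) : {poly R[i]} :=
  (1 + 'i%:P * 'X) ^+ (d - n) * (1 - 'i%:P * 'X) ^+ n.

Lemma size_frequency_poly (R : realType) (d n : nat) :
  (n <= d)%N -> (size (frequency_poly R d n) <= d.+1)%N.
Proof.
move=> lend; have sz (c : R[i]) m : (size ((1 + c%:P * 'X) ^+ m) <= m.+1)%N.
  apply: leq_trans (size_poly_exp_leq _ _) _; rewrite ltnS.
  rewrite -[leqRHS]mul1n leq_mul2r -subn1 leq_subLR addn1.
  rewrite addrC mul_polyC (leq_trans (size_polyD _ _)) ?orbT // geq_max.
  by rewrite size_poly1 (leq_trans (size_scale_leq _ _)) ?size_polyX // orbT.
apply: leq_trans (size_polyMleq _ _) _.
rewrite -mulNr -polyCN -subn1 leq_subLR add1n.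
apply: leq_trans (leq_add (sz _ _) (sz _ _)) _.
by rewrite addnS addSn subnK.
Qed.

Lemma frequency_polyP (R : realType) (d n : nat) (x : R) :
  (n <= d)%N -> cos x != 0 ->
  expi x ^+ d / expi (x * 2) ^+ n =
    (cos x)%:C ^+ d * (frequency_poly R d n).[(tan x)%:C].
Proof.
move=> lend cx; rewrite /frequency_poly !hornerE.
have -> : expi x ^+ d / expi (x * 2) ^+ n = expi x ^+ (d - n) * expi (- x) ^+ n.
  apply: (canLR (mulfK (expf_neq0 _ (expi_neq0 _ _)))).
  rewrite -[2]/(2%:R) expiMn -mulrA -exprMn.
  rewrite [_ ^+ 2]expr2 mulrA [expi (- x) * _]mulrC expi_mulN mul1r.
  by rewrite -exprD subnK.
rewrite (expi_cos_tan _ x) // (expi_cos_tan _ (- x)) cosN //.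
rewrite tanN rmorphN mulrN !exprMn -{3}(subnK lend) exprD.
by rewrite mulrACA !mulrA.
Qed.

(** The symmetric range |l| <= m is moved to 0 <= n <= 2m by n = l + m, so that
    only natural exponents occur. *)
Lemma compact_support_shift (N m : nat) (k : 'I_N) :
  compact_support m.*2 k ->
  exists2 n : nat, (n <= m.*2)%N & (k + m = n %[mod N])%N.
Proof.
case=> l [kl].
have -> : (m.*2)%:Q / 2 = m%:Q by rewrite -muln2 PoszM intrM mulfK.
rewrite -rmorphN /= !ler_int => /andP[lel gel].
have l0 : (0 <= l + m)%R by lia.
exists `|(l + m)%R|%N; first by lia.
apply/eqP; rewrite -eqz_nat -!modz_nat gez0_abs // PoszD.
by rewrite -modzDml kl modzDml.
Qed.

(** At a real point, powers of x are real, so taking real parts acts on the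
    coefficients alone. *)
Lemma real_part_poly (R : rcfType) (q : {poly R[i]}) :
  exists2 p : {poly R}, (size p <= size q)%N &
    forall x, p.[x] = complex.Re q.[x%:C].
Proof.
exists (\poly_(i < size q) complex.Re q`_i) => [|x]; first exact: size_poly.
rewrite horner_poly horner_coef (raddf_sum (@complex.Re R : Rcomplex R -> R)).
apply: eq_bigr => i _; rewrite -rmorphXn /=; case: (q`_i) => a b.
by rewrite /= mulr0 subr0.
Qed.

(** A trigonometric polynomial of degree m is, up to the factor cos^{2m}, an
    ordinary polynomial of degree 2m in the tangent of the half angle. The
    real part of the complex polynomial obtained from the Fourier expansion
    will do, because the entries F_j are real. *)
Lemma bandlimited_polynomial (R : realType) (N m : nat) (F : N.-tuple R) :
  (forall k : 'I_N, ~ compact_support m.*2 k -> tnth (dft F) k = 0) ->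
  exists2 p : {poly R}, (size p <= m.*2.+1)%N &
    forall j : 'I_N, F`_j =
      cos (half_angle R N j) ^+ m.*2 * p.[tan (half_angle R N j)].
Proof.
move=> hf.
have /fin_all_exists[q /all_and2[size_q qP]] (k : 'I_N) :
    exists q : {poly R[i]}, (size q <= m.*2.+1)%N /\
      forall j : 'I_N, tnth (dft F) k / expi (omega R N j) ^+ k =
        (cos (half_angle R N j))%:C ^+ m.*2 * q.[(tan (half_angle R N j))%:C].
  have [->|fk_neq0] := eqVneq (tnth (dft F) k) 0.
    exists 0; rewrite size_poly0; split=> // j.
    by rewrite horner0 mul0r mulr0.
  have [n len kn] : exists2 n, (n <= m.*2)%N & (k + m = n %[mod N])%N.
    apply: compact_support_shift; apply: contrapT => /hf fk0.
    by rewrite fk0 eqxx in fk_neq0.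
  (* omega_j exceeds twice the half angle by an angle independent of j, which
     only contributes a constant factor. *)
  pose b := expi (pi - pi / N%:R : R).
  exists ((tnth (dft F) k * (b ^+ m / b ^+ n)) *: frequency_poly R m.*2 n).
  split=> [|j].
    by rewrite (leq_trans (size_scale_leq _ _)) ?size_frequency_poly.
  have N_gt0 : (0 < N)%N by apply: leq_ltn_trans (ltn_ord j).
  have cos_neq0 : cos (half_angle R N j) != 0.
    by rewrite gt_eqF // cos_half_angle_gt0.
  (* N-th roots of unity only see exponents modulo N. *)
  have wk : expi (omega R N j) ^+ k * expi (omega R N j) ^+ m =
            expi (omega R N j) ^+ n.
    rewrite -exprD -(expr_mod (k + m) (expi_omegaX R N j N_gt0)) kn.
    by rewrite expr_mod // expi_omegaX.
  have -> : (expi (omega R N j) ^+ k)^-1 =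
            expi (omega R N j) ^+ m / expi (omega R N j) ^+ n.
    by rewrite -wk invfM mulrC mulfVK // expf_neq0 // expi_neq0.
  rewrite hornerZ [RHS]mulrCA -frequency_polyP // omega_half_angle //.
  rewrite expiD -/b !exprMn -[2]/(2%:R) expiMn -!exprM !mul2n invfM; ring.
have [p size_p pP] := real_part_poly R (\sum_(k < N) q k).
exists p => [|j].
  apply: leq_trans size_p _; apply: leq_trans (size_sum _ _ _) _.
  by apply/bigmax_leqP => k _; apply: size_q.
have := dft_inversion R N F j; under eq_bigr do rewrite qP.
rewrite -mulr_sumr -horner_sum -rmorphXn pP => /(congr1 (@complex.Re R)) /= ->.
by case: (_.[_]) => a b /=; rewrite mul0r subr0.
Qed.

(** * Counting the sign changes *)

Theorem lemma1 (R : realType) (N tau : nat) (F : N.-tuple R)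
    (hN : (1 <= N)%N) (tau_even : ~~ odd tau) (tau_le : (tau <= N - 1)%N)
    (hf : forall k : 'I_N,
       ~ compact_support tau k -> tnth (dft F) k = 0) :
  (forall j : 'I_N,
     tnth (sign_vector F) j = 1 \/ tnth (sign_vector F) j = -1) /\
  (sign_changes (sign_vector F) <= tau)%N.
Proof.
split=> [j|]; first by rewrite tnth_mktuple; apply: sign_atP.
have := even_halfK tau_even; move: (tau./2) => m tauE; rewrite -tauE in hf *.
have [p size_p pP] := bandlimited_polynomial R N m F hf.
pose x j := tan (half_angle R N j).
have FE j : (j < N)%N -> exists2 c, 0 < c & F`_j = c * p.[x j].
  move=> ltjN; exists (cos (half_angle R N j) ^+ m.*2); last first.
    exact: (pP (Ordinal ltjN)).
  by rewrite exprn_gt0 // cos_half_angle_gt0.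
suff : (sign_changes (sign_vector F) <= (size p).-1)%N.
  by move=> /leq_trans; apply; rewrite -subn1 leq_subLR add1n.
apply: (card_poly_sign_changes R p N.-1 x) => [i j ltij lejN|j].
  have ltjN : (j < N)%N by rewrite -(prednK hN).
  by rewrite ltr_tan ?half_angle_itv ?ltr_half_angle // (ltn_trans ltij).
have ltj1N : (j.+1 < N)%N by rewrite -ltn_predRL.
have ltjN := ltnW ltj1N.
have nth_s i : (i < N)%N -> (sign_vector F)`_i = sign_at (nth 0 F) i.
  by move=> ltiN; rewrite (nth_mktuple _ _ (Ordinal ltiN)).
rewrite inE !nth_s // => /sign_at_change.
have [c c_gt0 ->] := FE _ ltjN; have [d d_gt0 ->] := FE _ ltj1N.
by rewrite mulf_eq0 gt_eqF //= mulrACA pmulr_rle0 // mulr_gt0.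
Qed.
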